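(* There exists a constant $c>0$ such that, for any integer $n\ge 16$ and any $\delta\in(0,1/(16e^2)]$, $$\sup_{x_1,\dots,x_n\in\mathbb R^2}\ \sup_{\theta^\star\in\mathbb R^2}\ \mathsf Q_{1-\delta}\Big(\Lambda_n^{\log}(\theta^\star;x_{1:n};Y_{1:n})\Big)\ge c\Big(\log\log\log n+\log\frac1\delta\Big).$$
   Context: $\sigma(t)=1/(1+e^{-t})$. For deterministic $x_1,\dots,x_n\in\mathbb R^2$ and $\theta^\star\in\mathbb R^2$, the labels $Y_1,\dots,Y_n\in\{-1,1\}$ are independent with $\mathbf P(Y_i=1)=\sigma(\langle x_i,\theta^\star\rangle)$, and $$\Lambda_n^{\log}(\theta^\star;x_{1:n};Y_{1:n})=\log\frac{\sup_{\theta\in\mathbb R^2}\prod_{i=1}^n\sigma(Y_i\langle x_i,\theta\rangle)}{\prod_{i=1}^n\sigma(Y_i\langle x_i,\theta^\star\rangle)}.$$ For a real random variable $Z$, $\mathsf Q_{1-\delta}(Z)=\inf\{z\in\mathbb R:\mathbf P(Z\le z)\ge 1-\delta\}$; here the randomness is over $Y_{1:n}$. All logarithms are natural. *)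

(* Defs.v *)
From HB Require Import structures.
From mathcomp Require Import all_boot all_order all_algebra.
From mathcomp Require Import all_classical all_reals all_analysis.

Set Implicit Arguments.
Unset Strict Implicit.
Unset Printing Implicit Defensive.

Import Order.TTheory GRing.Theory Num.Theory.
Import numFieldNormedType.Exports.

Local Open Scope classical_set_scope.
Local Open Scope ring_scope.

(* Extended-real valued; the infimum of the empty set is +oo. *)
Definition quantile {R : realType} {d : measure_display} {T : measurableType d}
    (P : probability T R) (p : R) (Z : T -> R) : \bar R :=
  ereal_inf (EFin @` [set z : R | (p%:E <= P [set w | Z w <= z]%R)%E]).

Definition sigmoid {R : realType} (t : R) : R := (1 + expR (- t))^-1.

Definition dotp {R : realType} {k : nat} (u v : 'rV[R]_k) : R :=
  \sum_j u 0 j * v 0 j.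

Lemma sigmoid01 {R : realType} (t : R) : 0 <= sigmoid t <= 1.
Proof.
have h : 0 < 1 + expR (- t) :> R by rewrite ltr_pwDl ?expR_ge0.
by rewrite invr_ge0 ltW //= invf_le1 // lerDl expR_ge0.
Qed.

(* Sample space of the n labels, with its discrete sigma-algebra.  The boolean
   true stands for the label 1 and false for the label -1. *)
Definition label_space (n : nat) : Type := {ffun 'I_n -> bool}.

HB.instance Definition _ (n : nat) :=
  Finite.copy (label_space n) {ffun 'I_n -> bool}.

HB.instance Definition _ (n : nat) :=
  isPointed.Build (label_space n) [ffun=> false].

HB.instance Definition _ (n : nat) :=
  @isMeasurable.Build default_measure_display (label_space n)
    discrete_measurable discrete_measurable0
    discrete_measurableC discrete_measurableU.

Definition label {R : realType} {n : nat} (i : 'I_n) (w : label_space n) : R :=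
  if w i then 1 else -1.

(* Joint law of independent labels with P(Y_i = 1) = sigmoid <x_i, theta>:
   the product of the Bernoulli laws of the coordinates. *)
Section label_law.
Context {R : realType} {k n : nat} (x : 'I_n -> 'rV[R]_k) (theta : 'rV[R]_k).

Definition label_pmf (w : label_space n) : R :=
  \prod_(i < n) bernoulli_pmf (sigmoid (dotp (x i) theta)) (w i).

Definition label_law (A : set (label_space n)) : \bar R :=
  (\sum_(w : label_space n | w \in A) label_pmf w)%:E.

Lemma label_pmf_ge0 w : 0 <= label_pmf w.
Proof. by apply: prodr_ge0 => i _; apply/bernoulli_pmf_ge0/sigmoid01. Qed.

Lemma label_lawE A : label_law A = (\esum_(w in A) (label_pmf w)%:E)%E.
Proof.
have fA : finite_set A by exact: finite_finset.
rewrite esum_fset //; last by move=> w _; rewrite lee_fin label_pmf_ge0.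
rewrite fsbig_finite //= sumEFin /label_law; congr EFin.
rewrite -[LHS]big_filter; apply: perm_big; apply: uniq_perm.
- by rewrite filter_uniq // index_enum_uniq.
- exact: finmap.fset_uniq.
- by move=> w; rewrite mem_filter mem_index_enum andbT in_fset_set.
Qed.

Let label_law0 : label_law set0 = 0%E.
Proof. by rewrite /label_law big1 // => w; rewrite inE. Qed.

Let label_law_ge0 A : (0 <= label_law A)%E.
Proof. by rewrite lee_fin sumr_ge0 // => w _; exact: label_pmf_ge0. Qed.

Let label_law_sigma_additive : semi_sigma_additive label_law.
Proof.
move=> F mF tF mUF; apply: cvg_toP.
  apply: ereal_nondecreasing_is_cvgn => p q pq.
  by apply: lee_sum_nneg_natr => // j _ _; exact: label_law_ge0.
under eq_eseriesr do rewrite label_lawE.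
rewrite label_lawE -nneseries_sum_bigcup // => w.
by rewrite lee_fin label_pmf_ge0.
Qed.

HB.instance Definition _ := isMeasure.Build _ _ _ label_law
  label_law0 label_law_ge0 label_law_sigma_additive.

Lemma label_law_prod (B : 'I_n -> set bool) :
  label_law [set w | forall i, B i (w i)] =
  (\prod_(i < n) \sum_(b | b \in B i)
     bernoulli_pmf (sigmoid (dotp (x i) theta)) b)%:E.
Proof.
rewrite /label_law bigA_distr_big_dep; congr EFin.
apply: eq_bigl => w; apply/idP/familyP.
  by move=> /set_mem Bw i; apply/mem_set/Bw.
by move=> Bw; apply/mem_set => i; apply/set_mem/Bw.
Qed.

Let label_law_setT : label_law [set: label_space n] = 1%E.
Proof.
have -> : [set: label_space n] = [set w | forall i, [set: bool] (w i)].
  by apply/seteqP; split.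
rewrite (label_law_prod (fun=> setT)) big1 // => i _.
rewrite (eq_bigl predT); last by move=> b; rewrite in_setT.
by rewrite big_bool /= addrC subrK.
Qed.

HB.instance Definition _ :=
  Measure_isProbability.Build _ _ R label_law label_law_setT.

(* The coordinates are mutually independent with the prescribed marginals. *)
Lemma label_law_independent (B : 'I_n -> set R) :
  label_law (\bigcap_i (label i @^-1` B i)) =
  (\prod_(i < n) label_law (label i @^-1` B i))%E.
Proof.
pose C i : set bool := [set b | B i (if b then 1 else -1)].
have -> : \bigcap_i (label i @^-1` B i) = [set w | forall i, C i (w i)].
  by apply/seteqP; split=> w /= h i; [exact: (h i)|move=> _; exact: (h i)].
rewrite label_law_prod -prodEFin; apply: eq_bigr => i _.
have -> : label i @^-1` B i =
    [set w | forall j, (if j == i then C i else setT) (w j)].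
  apply/seteqP; split=> w /= h; last by have := h i; rewrite eqxx.
  by move=> j; case: eqP => [->|].
rewrite (label_law_prod (fun j => if j == i then C i else setT)).
rewrite (bigD1 i) //= eqxx [X in _ * X]big1 ?mulr1 // => j ji.
rewrite (negbTE ji) (eq_bigl predT); last by move=> b; rewrite in_setT.
by rewrite big_bool /= addrC subrK.
Qed.

Lemma label_law_marginal (i : 'I_n) :
  label_law [set w | label i w = 1 :> R] =
  (sigmoid (dotp (x i) theta))%:E.
Proof.
have -> : [set w | label i w = 1 :> R] =
    [set w | forall j, (if j == i then [set true] else setT) (w j)].
  apply/seteqP; split=> w /=.
    rewrite /label => h j; case: eqP => [->|//]; move: h; case: (w i) => //.
    by move=> /eqP; rewrite eq_sym -addr_eq0 (_ : 1 + 1 = 2%:R) // pnatr_eq0.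
  by move=> /(_ i); rewrite eqxx /label /= => ->.
rewrite (label_law_prod (fun j => if j == i then [set true] else setT)).
rewrite (bigD1 i) //= eqxx [X in _ * X]big1 ?mulr1 => [|j ji].
  by rewrite (big_pred1 true) // => b; apply/idP/eqP => [/set_mem|->] //; exact/mem_set.
rewrite (negbTE ji) (eq_bigl predT); last by move=> b; rewrite in_setT.
by rewrite big_bool /= addrC subrK.
Qed.

End label_law.

Section likelihood_ratio.
Context {R : realType} {k n : nat}.

Definition likelihood (x : 'I_n -> 'rV[R]_k) (y : 'I_n -> R)
    (theta : 'rV[R]_k) : R :=
  \prod_(i < n) sigmoid (y i * dotp (x i) theta).

(* The supremum is that of a nonempty set bounded by 1, so sup is faithful. *)
Definition log_likelihood_ratio (theta : 'rV[R]_k) (x : 'I_n -> 'rV[R]_k)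
    (y : 'I_n -> R) : R :=
  ln (sup (range (likelihood x y)) / likelihood x y theta).

End likelihood_ratio.

(* Main.v *)
Require Import Defs.
From mathcomp Require Import all_boot all_order all_algebra.
From mathcomp Require Import all_classical all_reals all_analysis.
From mathcomp Require Import ring lra zify.
Import Order.TTheory GRing.Theory Num.Theory.
Import numFieldNormedType.Exports.
Local Open Scope classical_set_scope.
Local Open Scope ring_scope.

(* The term [log (1/delta)] comes from a single nonzero covariate whose rare
   label has probability about [2 delta].

   For the triple logarithm, put the covariates on the parabola
   [x_i = (s_i, s_i^2)] with [theta* = (1, 0)], so that [Y_i = -1] has
   probability about [exp (- s_i)].  The scales [s_i] take the values
   [K^k log K], [k < K], with multiplicity about [K^(K^k - 1)]; each scale then
   carries an expected number [1/K] of negative labels, and [n] covariates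
   accommodate [K] of order [sqrt (log log n)].  With probability bounded below,
   exactly one label is negative, say at scale [s_i].  Moving [theta*] by
   [- L (2 / s_i, - 1 / s_i^2)], [L = log K], multiplies the odds of a negative
   label at scale [r s_i] by [exp (L (2 r - r^2))]: a factor [K] at the observed
   scale, and a bounded factor at all the others, whose ratios [r] are powers of
   [K].  Hence the log-likelihood increases by [log K - O(1)]. *)

(** * Quantile lower bounds from events *)

Lemma quantile_ge {R : realType} {d : measure_display} {T : measurableType d}
    (P : probability T R) (delta t : R) (Z : T -> R) (E : set T) :
  (forall z, measurable [set w | Z w <= z]) -> measurable E ->
  (delta%:E < P E)%E -> (forall w, E w -> t <= Z w) ->
  (t%:E <= quantile P (1 - delta) Z)%E.
Proof.
move=> mZ mE PE tZ; apply: le_ereal_inf_tmp => _ [z /= zP <-].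
rewrite lee_fin leNgt; apply/negP => zt.
(* On [E] the statistic is at least [t > z], so its sublevel set at [z] misses [E] and has
   probability below [1 - delta]. *)
have sub : [set w | Z w <= z] `<=` ~` E.
  by move=> w /= Zz /tZ tw; have := le_lt_trans (le_trans tw Zz) zt; rewrite ltxx.
have := le_trans zP (le_measure P (mem_set (mZ z)) (mem_set (measurableC mE)) sub).
rewrite [leRHS]probability_setC // leNgt => /negP; apply.
rewrite -(fineK (fin_num_measure P _ mE)) in PE *.
by rewrite -EFinB lte_fin ltrD2l ltrN2 -lte_fin.
Qed.

(** * Exponential bounds on the sigmoid *)

Section sigmoid.
Context {R : realType}.
Implicit Types t : R.

Lemma sigmoid_gt0 t : 0 < sigmoid t.
Proof. by rewrite invr_gt0 ltr_wpDl ?expR_gt0. Qed.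

Lemma sigmoidN t : sigmoid (- t) = 1 - sigmoid t.
Proof.
rewrite /sigmoid opprK expRN; have := expR_gt0 t => e0.
field; do ?(apply/andP; split); rewrite lt0r_neq0 //; lra.
Qed.

Lemma sigmoid_ge_expR t : expR (- expR (- t)) <= sigmoid t.
Proof.
by rewrite expRN lef_pV2 ?expR_ge1Dx ?posrE ?expR_gt0 ?ltr_wpDl ?expR_gt0.
Qed.

Lemma sigmoid_le_expR t : sigmoid t <= expR t.
Proof.
rewrite -[leRHS]invrK -expRN lef_pV2 ?posrE ?expR_gt0 ?ltr_wpDl ?expR_gt0 //.
by rewrite lerDr.
Qed.

Lemma sigmoid_ge_half_expR t : t <= 0 -> expR t / 2 <= sigmoid t.
Proof.
move=> t0; rewrite -[leLHS]invrK lef_pV2 ?posrE ?ltr_wpDl ?expR_gt0 //.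
  rewrite invfM invrK -expRN.
  have : 1 <= expR (- t) by rewrite -expR0 ler_expR oppr_ge0.
  lra.
by rewrite invr_gt0 divr_gt0 ?expR_gt0.
Qed.

(** Reduces every product of probabilities of positive labels to a sum of exponentials, which is
    what the designs control. *)
Lemma prodr_sigmoid_ge (I : finType) (Q : pred I) (f : I -> R) :
  expR (- \sum_(i | Q i) expR (- f i)) <= \prod_(i | Q i) sigmoid (f i).
Proof.
rewrite -sumrN expR_sum; apply: ler_prod => i _.
by rewrite expR_ge0 sigmoid_ge_expR.
Qed.

End sigmoid.

(** * Competing parameters in the likelihood ratio *)

Section likelihood.
Context {R : realType} {k n : nat}.
Implicit Types (x : 'I_n -> 'rV[R]_k) (y : 'I_n -> R) (theta : 'rV[R]_k).

Lemma likelihood_gt0 x y theta : 0 < likelihood x y theta.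
Proof. by apply: prodr_gt0 => i _; exact: sigmoid_gt0. Qed.

Lemma ln_le_log_likelihood_ratio x y theta theta' r : 0 < r ->
  r * likelihood x y theta <= likelihood x y theta' ->
  ln r <= log_likelihood_ratio theta x y.
Proof.
move=> r0 le_r; have l0 := likelihood_gt0 x y theta.
have sup_ge : likelihood x y theta' <= sup (range (likelihood x y)).
  apply: ub_le_sup; last by exists theta'.
  exists 1 => _ [t _ <-]; apply: prodr_ile1 => i _.
  exact: sigmoid01.
have rs : r <= sup (range (likelihood x y)) / likelihood x y theta.
  by rewrite ler_pdivlMr // (le_trans le_r).
by rewrite /log_likelihood_ratio ler_ln // posrE (lt_le_trans r0).
Qed.

End likelihood.

Definition pair_row {R : realType} (a b : R) : 'rV[R]_2 :=
  \row_j (if j == 0 then a else b).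

Lemma dotp_pair_row {R : realType} (a b c d : R) :
  dotp (pair_row a b) (pair_row c d) = a * c + b * d.
Proof. by rewrite /dotp !big_ord_recl big_ord0 !mxE /= addr0. Qed.

(** * Outcomes with a single negative label *)

Section one_exceptional_label.
Context {R : realType} {n : nat}.

Definition only_neg (i : 'I_n) : label_space n := [ffun j => j != i].

Lemma only_neg_inj : injective only_neg.
Proof.
move=> i j /ffunP /(_ j); rewrite !ffunE eqxx => /negbFE/eqP.
by [].
Qed.

Lemma label_only_neg (i j : 'I_n) :
  label j (only_neg i) = if j == i then -1 else 1 :> R.
Proof. by rewrite /label ffunE; case: eqP. Qed.

Lemma label_law_only_neg {k : nat} (x : 'I_n -> 'rV[R]_k) theta (B : {set 'I_n}) :
  label_law x theta [set only_neg i | i in [set` B]] =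
  (\sum_(i in B) (sigmoid (- dotp (x i) theta) *
     \prod_(j | j != i) sigmoid (dotp (x j) theta)))%:E.
Proof.
rewrite /label_law; congr EFin.
rewrite (eq_bigl (mem (only_neg @: B))); last first.
  move=> w; apply/idP/imsetP => [/set_mem[i iB <-]|[i iB ->]].
    by exists i.
  by apply/mem_set; exists i.
rewrite big_imset; last by move=> ? ? _ _; exact: only_neg_inj.
apply: eq_bigr => i _.
rewrite /label_pmf (bigD1 i) //= !ffunE eqxx /= sigmoidN; congr (_ * _).
by apply: eq_bigr => j ji; rewrite !ffunE ji.
Qed.

End one_exceptional_label.

(** * Covariates on the parabola *)

Section parabola_design.
Context {R : realType} {n : nat}.

(** The event is that exactly one label is negative, at an index of [B]. All other labels are
    positive with probability at least [expR (- a)], and [b / 2] bounds from below the sum over [B]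
    of the probabilities of a negative label. The tilted parameter gains [L], up to [ln 2], at the
    negative label, and [c] caps its loss on the positive ones. *)
Lemma quantile_parabola_design (s : 'I_n -> R) (B : {set 'I_n})
    (L a b c delta : R) :
  0 <= L -> (forall i, 0 < s i) -> (forall i, i \in B -> L <= s i) ->
  \sum_i expR (- s i) <= a -> b <= \sum_(i in B) expR (- s i) ->
  (forall i, i \in B ->
     \sum_j expR (L * (2 * (s j / s i) - (s j / s i) ^+ 2) - s j) <= c) ->
  delta < b / 2 * expR (- a) ->
  ((L - c - ln 2)%:E <=
    quantile (label_law (fun i => pair_row (s i) (s i ^+ 2)) (pair_row 1 0))
      (1 - delta)
      (fun w => log_likelihood_ratio (pair_row 1 0)
         (fun i => pair_row (s i) (s i ^+ 2)) (fun i => label i w)))%E.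
Proof.
move=> L0 s0 LB sum_a sum_b sum_c dlt.
apply: (@quantile_ge _ _ _ _ _ _ _ [set only_neg i | i in [set` B]]) => //.
  rewrite -[ltRHS]/(label_law _ _ _) label_law_only_neg lte_fin; apply: (lt_le_trans dlt).
  rewrite -mulrA; apply: le_trans (ler_wpM2r _ sum_b) _.
    by rewrite mulr_ge0 ?expR_ge0.
  rewrite mulr_suml; apply: ler_sum => i _.
  rewrite dotp_pair_row mulr1 mulr0 addr0 mulrA; apply: ler_pM.
  - by rewrite divr_ge0 ?expR_ge0.
  - exact: expR_ge0.
  - by rewrite sigmoid_ge_half_expR // oppr_le0 ltW.
  - under eq_bigr do rewrite dotp_pair_row mulr1 mulr0 addr0.
    apply: le_trans (prodr_sigmoid_ge _ _ _); rewrite ler_expR lerN2.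
    apply: le_trans sum_a; rewrite [leRHS](bigD1 i) //= lerDr; exact: expR_ge0.
move=> _ [i /= iB <-].
have si0 : s i != 0 by rewrite gt_eqF.
have -> : L - c - ln 2 = ln (expR (L - c) / 2).
  by rewrite lnM ?posrE ?expR_gt0 // expRK lnV ?posrE.
pose theta' : 'rV[R]_2 := pair_row (1 - 2 * L / s i) (L / s i ^+ 2).
apply: (@ln_le_log_likelihood_ratio _ _ _ _ _ _ theta').
  by rewrite divr_gt0 ?expR_gt0.
pose g j := L * (2 * (s j / s i) - (s j / s i) ^+ 2).
have dotpE j : dotp (pair_row (s j) (s j ^+ 2)) theta' = s j - g j.
  by rewrite dotp_pair_row /g; field.
have gi : g i = L by rewrite /g divff //; ring.
(* The hypothesis [L <= s i] keeps the tilted log-odds nonpositive, where the sigmoid is within a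
   factor 2 of the exponential; this factor is the [ln 2] of the conclusion. *)
have le_i : sigmoid (- s i) * expR L / 2 <= sigmoid (- (s i - g i)).
  apply: le_trans (sigmoid_ge_half_expR _ _); last first.
    by rewrite gi oppr_le0 subr_ge0 LB.
  rewrite gi opprB expRD ler_pM2r ?invr_gt0 // mulrC ler_pM2l ?expR_gt0 //.
  exact: sigmoid_le_expR.
rewrite /likelihood (bigD1 i) //= [leRHS](bigD1 i) //=.
rewrite label_only_neg eqxx !mulN1r dotpE dotp_pair_row mulr1 mulr0 addr0.
(* Under the true parameter the positive labels contribute at most 1, so only their tilted product
   needs a lower bound. *)
have p1 : \prod_(j < n | j != i) sigmoid (label j (only_neg i) *
     dotp (pair_row (s j) (s j ^+ 2)) (pair_row 1 0)) <= 1.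
  by apply: prodr_ile1 => j _; exact: sigmoid01.
have p2 : expR (- c) <= \prod_(j < n | j != i) sigmoid (label j (only_neg i) *
     dotp (pair_row (s j) (s j ^+ 2)) theta').
  rewrite (eq_bigr (fun j => sigmoid (s j - g j))); last first.
    by move=> j ji; rewrite label_only_neg (negbTE ji) mul1r dotpE.
  apply: le_trans (prodr_sigmoid_ge _ _ _); rewrite ler_expR lerN2.
  apply: le_trans (sum_c i iB); rewrite [leRHS](bigD1 i) //=.
  rewrite ler_wpDl ?expR_ge0 //; apply: ler_sum => j _.
  by rewrite opprB.
have -> : forall p, expR (L - c) / 2 * (sigmoid (- s i) * p) =
    sigmoid (- s i) * expR L / 2 * (p * expR (- c)).
  by move=> p; rewrite expRD; ring.
apply: ler_pM => //.
- by rewrite divr_ge0 // mulr_ge0 ?expR_ge0 // ltW ?sigmoid_gt0.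
- by rewrite mulr_ge0 ?expR_ge0 // prodr_ge0 // => j _; rewrite ltW ?sigmoid_gt0.
- apply: le_trans p2; rewrite ler_piMl ?expR_ge0 //.
Qed.

End parabola_design.

(** * A single nonzero covariate *)

Lemma quantile_single_design {R : realType} {n : nat} (i0 : 'I_n) (delta : R) :
  0 < delta -> delta < 2^-1 ->
  exists x : 'I_n -> 'rV[R]_2, exists theta,
  ((ln delta^-1 - ln 2)%:E <=
    quantile (label_law x theta) (1 - delta)
      (fun w => log_likelihood_ratio theta x (fun i => label i w)))%E.
Proof.
(* With this [s] the label -1 at [i0] has probability [2 * delta / (1 + 2 * delta)], above [delta]
   since [delta < 1/2]. When it occurs, flipping the sign of the parameter multiplies the likelihood
   by exactly [expR s]. *)
move=> d0 d1; pose s : R := ln (2 * delta)^-1.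
have es : expR s = (2 * delta)^-1 by rewrite lnK // posrE invr_gt0 mulr_gt0.
pose x (i : 'I_n) : 'rV[R]_2 := pair_row (i == i0)%:R 0.
exists x, (pair_row s 0).
have dx i t : dotp (x i) (pair_row t 0) = (i == i0)%:R * t.
  by rewrite dotp_pair_row mulr0 addr0.
apply: (@quantile_ge _ _ _ _ _ _ _ [set w : label_space n | w i0 = false]) => //.
  have -> : [set w : label_space n | w i0 = false] =
      ~` [set w | label i0 w = 1 :> R].
    apply/seteqP; split=> w /=; rewrite /label; first by move=> ->; lra.
    by case: (w i0).
  rewrite probability_setC // [X in (_ - X)%E]label_law_marginal dx eqxx mul1r.
  rewrite -EFinB lte_fin -sigmoidN /sigmoid opprK es.
  rewrite -[ltLHS]invrK ltf_pV2 ?posrE ?invr_gt0 //; last first.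
    by rewrite addr_gt0 // invr_gt0 mulr_gt0.
  rewrite invfM.
  have : 2 < delta^-1 by rewrite -[ltLHS]invrK ltf_pV2 // posrE invr_gt0.
  lra.
move=> w /= wi0.
have -> : ln delta^-1 - ln 2 = ln (expR s).
  by rewrite es invfM lnM ?posrE ?invr_gt0 // (@lnV _ 2) ?posrE // addrC.
apply: (@ln_le_log_likelihood_ratio _ _ _ _ _ _ (pair_row (- s) 0)).
  exact: expR_gt0.
rewrite /likelihood (bigD1 i0) //= [leRHS](bigD1 i0) //= /label wi0.
rewrite !dx eqxx !mul1r !mulN1r opprK mulrA.
rewrite le_eqVlt; apply/orP; left; apply/eqP; congr (_ * _).
  rewrite /sigmoid opprK expRN; have := expR_gt0 s => e0.
  by field; do ?(apply/andP; split); rewrite lt0r_neq0 //; lra.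
by apply: eq_bigr => i ii; rewrite !dx (negbTE ii) !mul0r.
Qed.

(** * Doubly exponential blocks of indices *)

Lemma sum1_ord_interval (a b n : nat) : (b <= n)%N ->
  (\sum_(i < n | (a <= i < b)%N) 1 = b - a)%N.
Proof.
move=> bn; rewrite -(big_mkord (fun i => a <= i < b)%N (fun=> 1%N)).
rewrite -[RHS]muln1 -sum_nat_const_nat (big_nat_widenl a 0) //.
by rewrite (big_nat_widen 0 b n).
Qed.

Section blocks.
Context (K n : nat) (K2 : (2 <= K)%N).

(** Exclusive end of block [k]. The predecessor makes [K * block_end k] equal to [K ^ (K ^ k)], the
    exponential of the scale of the block, so that [block_end k] labels at this scale have total
    weight [1 / K]. *)
Definition block_end (k : nat) : nat := K ^ (K ^ k).-1.

(* The indices beyond the last block all go to block [K + n], so far out that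
   their labels are almost deterministic. *)
Definition block (i : nat) : nat :=
  let k := find (fun k => i < block_end k)%N (iota 0 K) in
  if (k < K)%N then k else (K + n)%N.

Lemma block_endS k : (K * block_end k = K ^ (K ^ k))%N.
Proof. by rewrite /block_end -expnS prednK // expn_gt0; lia. Qed.

Lemma block_end_gt0 k : (0 < block_end k)%N.
Proof. by rewrite expn_gt0; lia. Qed.

(** The exponent increases by at least 1, hence a factor [K >= 2]. Consequently the upper half of
    the indices below [block_end k] lies beyond all earlier blocks. *)
Lemma block_end_lt j k : (j < k)%N -> (2 * block_end j <= block_end k)%N.
Proof.
move=> jk; apply: (@leq_trans (K * block_end j)); first by rewrite leq_mul2r K2 orbT.
rewrite block_endS /block_end leq_exp2l //.
have : (K ^ j < K ^ k)%N by rewrite ltn_exp2l.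
lia.
Qed.

Lemma lt_block_end i : (block i < K)%N -> (i < block_end (block i))%N.
Proof.
rewrite /block; case: ifP => [fK _|]; last by lia.
have hasf : has (fun k => i < block_end k)%N (iota 0 K) by rewrite has_find size_iota.
by have := nth_find 0%N hasf; rewrite nth_iota.
Qed.

Lemma block_eq i k : (k < K)%N -> ((block_end k)./2 <= i < block_end k)%N ->
  block i = k.
Proof.
move=> kK /andP[ki ik].
suff fk : find (fun k => i < block_end k)%N (iota 0 K) = k by rewrite /block fk kK.
have hasf : has (fun k => i < block_end k)%N (iota 0 K).
  by apply/hasP; exists k => //; rewrite mem_iota.
have fK : (find (fun k => i < block_end k) (iota 0 K) < K)%N.
  by rewrite -[ltnRHS](size_iota 0) -has_find.
have := nth_find 0%N hasf; rewrite nth_iota // add0n.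
set f := find _ _ in fK *; move=> fi.
have [fk|kf|//] := ltngtP f k.
  by have := block_end_lt _ _ fk; lia.
have := @before_find _ 0%N (fun k => i < block_end k)%N (iota 0 K) k kf.
by rewrite nth_iota // add0n ik.
Qed.

End blocks.

(** * Weights and tilts of the block design *)

Section block_design.
Context {R : realType}.
Context (K n : nat) (K2 : (2 <= K)%N) (Kn : (block_end K K.-1 <= n)%N).

Local Notation T := (block_end K).
Local Notation blk := (block K n).

Definition block_scale (i : nat) : R := (K ^ blk i)%:R * ln K%:R.

Local Notation s := block_scale.

Let lnK_gt0 : 0 < ln K%:R :> R.
Proof. by rewrite ln_gt0 // ltr1n. Qed.

Let K_gt0 : 0 < K%:R :> R.
Proof. by rewrite ltr0n; lia. Qed.

Let T_gt0 k : 0 < (T k)%:R :> R.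
Proof. by rewrite ltr0n block_end_gt0. Qed.

Let n_gt0 : (0 < n)%N.
Proof. by apply: leq_trans Kn; exact: block_end_gt0. Qed.

Lemma block_scale_gt0 i : 0 < s i.
Proof. by rewrite mulr_gt0 // ltr0n expn_gt0; lia. Qed.

Lemma expR_block_scale i : expR (- s i) = (K%:R * (T (blk i))%:R)^-1.
Proof.
by rewrite expRN /s mulrC expRM_natr lnK ?posrE // -natrX -natrM block_endS.
Qed.

Lemma sum_lt_le (t : nat) : \sum_(i < n) (i < t)%N%:R <= t%:R :> R.
Proof.
rewrite -natr_sum ler_nat -big_mkcond /=.
have := @sum1_ord_interval 0 (minn t n) n (geq_minr _ _).
rewrite subn0 => h; apply: (@leq_trans (minn t n)); last exact: geq_minl.
rewrite -h big_mkcond [leqRHS]big_mkcond; apply: leq_sum => i _ /=.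
by rewrite leq_min (ltn_ord i) andbT.
Qed.

(** Relaxing membership in block [k] to [i < T k] makes the later sum over [i] immediate. The term
    [n^-1] pays for the block [K + n], whose weight is [K ^ (K ^ (K + n))] inverted. *)
Lemma expR_block_scale_le (i : 'I_n) : expR (- s i) <=
  \sum_(k < K) (i < T k)%N%:R / (K%:R * (T k)%:R) + n%:R^-1.
Proof.
have ge0 (k : 'I_K) : 0 <= (i < T k)%N%:R / (K%:R * (T k)%:R) :> R.
  by rewrite divr_ge0 // mulr_ge0 // ltW.
have [iK|iK] := ltnP (blk i) K.
  rewrite (bigD1 (Ordinal iK)) //= (lt_block_end _ _ K2) // mul1r.
  rewrite expR_block_scale -addrA lerDl addr_ge0 ?invr_ge0 //.
  exact: sumr_ge0.
have bE : blk i = (K + n)%N by move: iK; rewrite /block; case: ifP; lia.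
apply: ler_wpDl; first exact: sumr_ge0.
rewrite expR_block_scale bE -natrM block_endS // lef_pV2 ?posrE ?ltr0n //; last first.
  by rewrite expn_gt0; lia.
rewrite ler_nat; apply: leq_trans (ltnW (ltn_expl _ K2)).
by apply: leq_trans (ltnW (ltn_expl _ K2)); lia.
Qed.

(** The [K] scales contribute at most [1 / K] each, and the terms [n^-1] add up to 1. *)
Lemma sum_expR_block_scale : \sum_(i < n) expR (- s i) <= 2.
Proof.
apply: (@le_trans _ _ (\sum_(i < n)
  (\sum_(k < K) (i < T k)%N%:R / (K%:R * (T k)%:R) + n%:R^-1))).
  by apply: ler_sum => i _; exact: expR_block_scale_le.
rewrite big_split /= sumr_const card_ord -[n%:R^-1 *+ n]mulr_natr mulVf; last first.
  by rewrite pnatr_eq0; lia.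
rewrite lerD2r exchange_big /=.
apply: (@le_trans _ _ (\sum_(k < K) K%:R^-1)).
  apply: ler_sum => k _; rewrite -mulr_suml invfM mulrCA ger_pMr ?invr_gt0 //.
  by rewrite ler_pdivrMr // mul1r sum_lt_le.
by rewrite sumr_const card_ord -[_ *+ K]mulr_natr mulVf // gt_eqF.
Qed.

Lemma block_end_le (k : nat) : (k < K)%N -> (T k <= n)%N.
Proof.
move=> kK; apply: leq_trans Kn; rewrite leq_exp2l //.
have : (K ^ k <= K ^ K.-1)%N by rewrite leq_exp2l //; lia.
lia.
Qed.

(** Block [k] contains at least half of the indices below [T k], each of weight [1 / (K * T k)];
    this gives [1 / (2 * K)] per block. *)
Lemma sum_expR_block_scale_ge :
  2^-1 <= \sum_(i in [set i : 'I_n | (blk i < K)%N]%SET) expR (- s i).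
Proof.
have -> : \sum_(i in [set i : 'I_n | (blk i < K)%N]%SET) expR (- s i) =
    \sum_(k < K) \sum_(i < n | blk i == k) (K%:R * (T k)%:R)^-1.
  rewrite (exchange_big_dep predT) // big_mkcond; apply: eq_bigr => i _.
  rewrite inE; case: ifPn => iK; last first.
    by rewrite big_pred0 // => k; apply/negbTE; apply: contra iK => /eqP ->.
  rewrite (big_pred1 (Ordinal iK)) ?expR_block_scale // => k.
  by apply/eqP/eqP => [ik|-> //]; apply/val_inj.
have -> : 2^-1 = \sum_(k < K) (2 * K%:R)^-1 :> R.
  rewrite sumr_const card_ord -[_ *+ K]mulr_natr invfM mulfVK ?gt_eqF //.
apply: ler_sum => k _; rewrite sumr_const.
have h : ((T k) <= 2 * #|[pred i : 'I_n | blk i == k]|)%N.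
  rewrite -sum1_card.
  have := @sum1_ord_interval (T k)./2 (T k) n (block_end_le _ (ltn_ord k)).
  have : (\sum_(i < n | (T k)./2 <= i < T k) 1 <=
      \sum_(i in [pred i : 'I_n | blk i == k]) 1)%N.
    rewrite big_mkcond [leqRHS]big_mkcond; apply: leq_sum => i _.
    case: ifP => // /(block_eq _ n K2 _ _ (ltn_ord k)) ik.
    by rewrite inE ik eqxx.
  move=> le_card card_eq; move: le_card; rewrite card_eq.
  set c := bigop _ _ _; lia.
rewrite -[leRHS]mulr_natr [leRHS]mulrC ler_pdivlMr ?mulr_gt0 // mulrC.
have -> : K%:R * (T k)%:R * (2 * K%:R)^-1 = (T k)%:R / 2 :> R.
  by field; rewrite gt_eqF.
by rewrite ler_pdivrMr // mulrC -natrM ler_nat.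
Qed.

Lemma sum_expR_block_tilt (i : 'I_n) : (blk i < K)%N ->
  \sum_(j < n) expR (ln K%:R * (2 * (s j / s i) - (s j / s i) ^+ 2) - s j)
    <= 2 * expR 2 + 1.
Proof.
move=> iK.
apply: (@le_trans _ _ (\sum_(j < n) (expR 2 * expR (- s j) +
    (j < T (blk i))%N%:R / (T (blk i))%:R))); last first.
  rewrite big_split /= -mulr_sumr -mulr_suml; apply: lerD.
    by rewrite mulrC ler_pM2r ?expR_gt0 // sum_expR_block_scale.
  by rewrite ler_pdivrMr // mul1r sum_lt_le.
apply: ler_sum => j _.
have T0 : 0 <= (j < T (blk i))%N%:R / (T (blk i))%:R :> R by rewrite divr_ge0.
have rE : s j / s i = (K ^ blk j)%:R / (K ^ blk i)%:R.
  by rewrite /s -mulf_div divff ?mulr1 ?gt_eqF.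
have [ji|ij|ij] := ltngtP (blk j) (blk i).
(* Smaller scales: the ratio is at most [1 / K], so the tilt is at most [2 * ln K / K <= 2]. *)
- apply: ler_wpDr => //; rewrite -expRD ler_expR lerD2r.
  have r_le : s j / s i <= K%:R^-1.
    rewrite rE ler_pdivrMr ?ltr0n ?expn_gt0; last by lia.
    by rewrite mulrC ler_pdivlMr // -natrM ler_nat -expnSr leq_exp2l.
  have r0 : 0 < s j / s i by rewrite divr_gt0 ?block_scale_gt0.
  have : ln K%:R / K%:R <= 1 :> R by rewrite ler_pdivrMr // mul1r ltW // ln_sublinear.
  have : ln K%:R * (s j / s i) <= ln K%:R / K%:R by rewrite ler_pM2l.
  move: lnK_gt0 => u0; have := sqr_ge0 (s j / s i); nra.
(* Larger scales: the ratio is at least 2, where the tilt is nonpositive. *)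
- apply: ler_wpDr => //; rewrite -expRD ler_expR lerD2r.
  have : 2 <= s j / s i.
    rewrite rE ler_pdivlMr ?ltr0n ?expn_gt0; last by lia.
    rewrite -natrM ler_nat; apply: (@leq_trans (K * K ^ blk i)).
      by rewrite leq_mul2r K2 orbT.
    by rewrite -expnS leq_exp2l.
  move=> r2; have : 0 <= ln K%:R * ((s j / s i) * (s j / s i - 2)).
    apply: mulr_ge0; first exact: ltW.
    by apply: mulr_ge0; lra.
  lra.
(* Same scale: the tilt cancels the factor [K] and leaves [1 / T] per index, for indices below [T]
   only. *)
- rewrite rE -ij divff; last by rewrite pnatr_eq0 -lt0n expn_gt0; lia.
  rewrite expr1n mulr1 (_ : 2 - 1 = 1); last by ring.
  have -> : expR (ln K%:R * 1 - s j) = (T (blk j))%:R^-1.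
    rewrite mulr1 expRD lnK ?posrE // expR_block_scale invfM mulVKf //.
    by rewrite gt_eqF.
  rewrite lt_block_end //; last by rewrite ij.
  by rewrite mul1r lerDr mulr_ge0 ?expR_ge0.
Qed.

Lemma quantile_block_design (delta : R) : delta < (4 * expR 1 ^+ 2)^-1 ->
  exists x : 'I_n -> 'rV[R]_2, exists theta,
  ((ln K%:R - (2 * expR 2 + 1) - ln 2)%:E <=
    quantile (label_law x theta) (1 - delta)
      (fun w => log_likelihood_ratio theta x (fun i => label i w)))%E.
Proof.
move=> dlt; exists (fun i => pair_row (s i) (s i ^+ 2)), (pair_row 1 0).
(* With [a = 2] and [b = 1/2], the event has probability at least [expR (- 2) / 4], whence the
   threshold on [delta]. *)
apply: (@quantile_parabola_design _ _ (fun i : 'I_n => s i)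
  [set i : 'I_n | (blk i < K)%N]%SET _ 2 2^-1).
- exact: ltW.
- by move=> i; exact: block_scale_gt0.
- by move=> i _; apply: ler_peMl; [exact: ltW|rewrite ler1n expn_gt0; lia].
- exact: sum_expR_block_scale.
- exact: sum_expR_block_scale_ge.
- by move=> i; rewrite inE; exact: sum_expR_block_tilt.
- apply: (lt_le_trans dlt); rewrite expRN -expRM_natl mulr1 invfM.
  rewrite ler_pM2r ?invr_gt0 ?expR_gt0 //; lra.
Qed.

End block_design.

(** * Choice of [K] and combination of the two designs *)

(** Since [ln] is 0 on nonpositive arguments, a positive logarithm alone forces [x > 1]. *)
Lemma gt1_ln_gt0 {R : realType} (x : R) : 0 < ln x -> 1 < x.
Proof. by move=> lx; rewrite ltNge; apply/negP => /ln_le0; rewrite leNgt lx. Qed.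

(** Two uses of [ln K <= K]: the last block ends before [expR (K ^ K)], and
    [K ^ K <= expR (K ^ 2) <= ln n]. *)
Lemma block_end_le_lnln {R : realType} (K n : nat) : (2 <= K)%N ->
  K%:R ^+ 2 <= ln (ln n%:R) :> R -> (block_end K K.-1 <= n)%N.
Proof.
move=> K2 Kn.
have K0 : 0 < K%:R :> R by rewrite ltr0n; lia.
have lnK_le : ln K%:R <= K%:R :> R by rewrite ltW // ln_sublinear.
have lnn1 : 1 < ln n%:R :> R by apply: gt1_ln_gt0; apply: lt_le_trans Kn; exact: exprn_gt0.
have n1 : 1 < n%:R :> R by apply: gt1_ln_gt0; lra.
have expK (m : nat) : (K ^ m)%:R = expR (m%:R * ln K%:R) :> R.
  by rewrite natrX expRM_natl lnK.
rewrite -(ler_nat R) /block_end expK -[leRHS]lnK ?posrE; last by lra.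
rewrite ler_expR; apply: (@le_trans _ _ ((K ^ K)%:R)).
  apply: (@le_trans _ _ ((K ^ K.-1)%:R * K%:R)); last by rewrite -natrM -expnSr prednK //; lia.
  apply: ler_pM => //; first by rewrite ln_ge0 // ler1n; lia.
  by rewrite ler_nat leq_pred.
rewrite expK -[leRHS]lnK ?posrE; last by lra.
rewrite ler_expR; apply: le_trans Kn.
by rewrite expr2 ler_pM2l.
Qed.

Lemma quantile_lnlnln {R : realType} (n : nat) (delta : R) :
  delta < (4 * expR 1 ^+ 2)^-1 -> 4 <= ln (ln n%:R) :> R ->
  exists x : 'I_n -> 'rV[R]_2, exists theta,
  ((ln (ln (ln n%:R)) / 2 - (2 * ln 2 + 2 * expR 2 + 1))%:E <=
    quantile (label_law x theta) (1 - delta)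
      (fun w => log_likelihood_ratio theta x (fun i => label i w)))%E.
Proof.
move=> dlt; set y := ln (ln _) => y4.
pose K := Num.truncn (Num.sqrt y).
have sy : Num.sqrt y ^+ 2 = y by rewrite sqr_sqrtr //; lra.
(* Rounding down costs one more [ln 2]: [sqrt y < K + 1 <= 2 * K], hence
   [ln K >= ln y / 2 - ln 2]. *)
have s0 : 0 <= Num.sqrt y := sqrtr_ge0 y.
have /andP[Ks sK] := truncn_itv s0.
rewrite -/K in Ks sK.
have K2 : (2 <= K)%N by rewrite truncn_ge_nat //; nra.
have K2R : 2 <= K%:R :> R by rewrite ler_nat.
have Ky : K%:R ^+ 2 <= y by rewrite -sy; nra.
have [x [theta q]] := quantile_block_design _ _ K2 (block_end_le_lnln _ _ K2 Ky) _ dlt.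
exists x, theta; apply: le_trans q; rewrite lee_fin.
suff : ln y <= 2 * ln 2 + 2 * ln K%:R by lra.
rewrite -mulrDr -lnM ?posrE; [|lra..].
rewrite mulr_natl -lnXn; last by lra.
rewrite ler_ln ?posrE; [|lra|by apply: exprn_gt0; lra].
rewrite -sy; move: sK; rewrite -natr1; nra.
Qed.

Theorem corollaryA1 (R : realType) :
  exists2 c : R, 0 < c &
    forall (n : nat) (delta : R), (16 <= n)%N ->
      0 < delta -> delta <= (16 * expR 1 ^+ 2)^-1 ->
      ((c * (ln (ln (ln n%:R)) + ln delta^-1))%:E <=
       ereal_sup (range (fun x : 'I_n -> 'rV[R]_2 =>
         ereal_sup (range (fun theta : 'rV[R]_2 =>
           quantile (label_law x theta) (1 - delta)
             (fun w => log_likelihood_ratio theta x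
                         (fun i => label i w)))))))%E.
Proof.
have ln2_gt0 : 0 < ln 2 :> R by rewrite ln_gt0 // ltr1n.
have e0 : 0 < expR 2 :> R := expR_gt0 2.
pose C : R := 2 * ln 2 + 2 * expR 2 + 1.
have C1 : 1 <= C by rewrite /C; lra.
exists (8 * C)^-1 => [|n delta n16 d0 dle]; first by rewrite invr_gt0; lra.
set S := ereal_sup _; set l := ln (ln (ln _)); set D := ln delta^-1.
have le_S (t : R) : (exists x : 'I_n -> 'rV[R]_2, exists theta,
    (t%:E <= quantile (label_law x theta) (1 - delta)
      (fun w => log_likelihood_ratio theta x (fun i => label i w)))%E) ->
    (t%:E <= S)%E.
  move=> [x [theta q]]; apply: (le_trans q).
  apply: le_ereal_sup_tmp; eexists; first by exists x.
  by apply: ereal_sup_ubound; exists theta.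
have e1 : expR 1 ^+ 2 = expR 2 :> R by rewrite -expRM_natl mulr1.
have e21 : 1 <= expR 2 :> R by rewrite -expR0 ler_expR.
have dinv : 16 * expR 2 <= delta^-1.
  by rewrite -e1 -[leLHS]invrK lef_pV2 // posrE invr_gt0 e1; lra.
have D_ge : 4 * ln 2 + 2 <= D.
  have -> : 4 * ln 2 + 2 = ln (16 * expR 2) :> R.
    rewrite lnM ?posrE // expRK (_ : 16 = 2 ^+ 4) ?lnXn ?mulr_natl //.
    by rewrite -natrX.
  by rewrite ler_ln // posrE ?invr_gt0 //; lra.
have d_lt : delta < (4 * expR 1 ^+ 2)^-1.
  apply: (le_lt_trans dle); rewrite e1 ltf_pV2 ?posrE; lra.
(* The loss [ln 2] of the single design is at most [D / 2]. *)
have S_D : ((D / 2)%:E <= S)%E.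
  have d2 : delta < 2^-1.
    by rewrite -[delta]invrK ltf_pV2 ?posrE ?invr_gt0 //; lra.
  have n0 : (0 < n)%N by lia.
  apply: le_trans (le_S _ (quantile_single_design (Ordinal n0) _ d0 d2)).
  by rewrite lee_fin -/D; lra.
have c8 : (8 * C)^-1 * 8 <= 1 by rewrite mulrC ler_pdivrMr; lra.
have c0 : 0 < (8 * C)^-1 by rewrite invr_gt0; lra.
(* If [l >= 4 * C], then [l / 2 - C >= l / 4], and the larger of [l] and [D] dominates the sum
   because [(8 * C)^-1 <= 1/8]. Otherwise [l] contributes at most [1/2], which [D >= 2] absorbs. *)
have [lC|lC] := leP (4 * C) l.
  have y1 : 1 < ln (ln n%:R) :> R by apply: gt1_ln_gt0; rewrite -/l; lra.
  have y4 : 4 <= ln (ln n%:R) :> R.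
    rewrite -ler_ln ?posrE //; last by lra.
    rewrite -/l (_ : 4 = 2 ^+ 2) ?lnXn //; last by rewrite -natrX.
    by move: lC; rewrite /C mulr2n; lra.
  have S_l : ((l / 4)%:E <= S)%E.
    apply: le_trans (le_S _ (quantile_lnlnln _ _ d_lt y4)).
    by rewrite lee_fin -/l -/C; lra.
  have [Dl|lD] := leP D l.
    by apply: le_trans S_l; rewrite lee_fin; nra.
  by apply: le_trans S_D; rewrite lee_fin; nra.
apply: le_trans S_D; rewrite lee_fin.
have : (8 * C)^-1 * (4 * C) = 2^-1 by field; lra.
nra.
Qed.
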